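(* Let $F$ be any probability distribution function on $\mathbb{R}$, let $p\in(0,1)$ and $n\in\mathbb{N}$. Then $$n\mu_{p,q}-(F^{-1}(q)-F^{-1}(p))\le \sup_{S\in\mathfrak S_n}\mathrm{VaR}_p(S)\le n\mu_{p,1}$$ for any $q\in(p,1]$, and $$n\mu_{0,p}\le \inf_{S\in\mathfrak S_n}\mathrm{VaR}_p(S)\le n\mu_{q,p}+(F^{-1}(p)-F^{-1}(q))$$ for any $q\in[0,p)$. In particular, if $F$ is a distribution on $[a,b]$, $a,b\in\mathbb{R}$, then for $p\in(0,1)$, $$n\mu_{p,1}-(b-F^{-1}(p))\le \sup_{S\in\mathfrak S_n}\mathrm{VaR}_p(S)\le n\mu_{p,1}$$ and $$n\mu_{0,p}\le \inf_{S\in\mathfrak S_n}\mathrm{VaR}_p(S)\le n\mu_{0,p}+(F^{-1}(p)-a).$$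
   Context: All random variables are defined on a common atomless probability space $(\Omega,\mathcal A,\mathbb P)$, on which independent random vectors with any distributions can be generated. For a distribution $F$, $\mathfrak S_n=\{X_1+\cdots+X_n: X_i\sim F,\ i=1,\ldots,n\}$ (sums with arbitrary dependence). $F^{-1}(t)=\inf\{x:F(x)\ge t\}$ for $t\in(0,1]$ and $F^{-1}(0)=\inf\{x:F(x)>0\}$. The Value-at-Risk is $\mathrm{VaR}_p(X)=\inf\{x:\mathbb P(X\le x)\ge p\}$, $p\in(0,1)$. For $1\ge q>p\ge 0$, $\mu_{p,q}=\frac{1}{q-p}\int_p^q F^{-1}(t)\,dt$; the values $\mu_{0,q}$ and $\mu_{p,1}$ may be infinite ($F$ is not assumed to have a finite mean). If $F^{-1}(q)=\infty$ (only possible for $q=1$), the lower bound in the first display is read as $-\infty$; if $F^{-1}(q)=-\infty$ (only possible for $q=0$), the upper bound in the second display is read as $+\infty$; in these cases those bounds are trivial. *)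

(* Defs.v *)
From HB Require Import structures.
From mathcomp Require Export all_boot all_order all_algebra.
From mathcomp Require Export all_classical all_reals all_analysis.

Set Implicit Arguments.
Unset Strict Implicit.
Unset Printing Implicit Defensive.

Export Order.TTheory GRing.Theory Num.Theory.
Export numFieldNormedType.Exports.

Local Open Scope classical_set_scope.
Local Open Scope ring_scope.
Local Open Scope ereal_scope.

Definition atomless d (T : measurableType d) (R : realType)
    (P : probability T R) : Prop :=
  forall A : set T, measurable A -> 0 < P A ->
    exists B : set T, [/\ measurable B, B `<=` A & 0 < P B < P A].

(* The product rule is only asked for the full family: taking A i := setT
   for the other indices yields it for every subfamily. *)
Definition independent_vectors d (T : measurableType d) (R : realType)
    (P : probability T R) (m : nat) (k : 'I_m -> nat)
    (X : forall i : 'I_m, {RV P >-> (k i).-tuple R}) : Prop :=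
  forall A : forall i : 'I_m, set ((k i).-tuple R),
    (forall i, measurable (A i)) ->
    P (\bigcap_(i in [set: 'I_m]) (X i @^-1` A i)) =
    \prod_(i < m) P (X i @^-1` A i).

(* Independent random vectors with any prescribed distributions exist on
   the probability space. *)
Definition generates_independent_vectors d (T : measurableType d)
    (R : realType) (P : probability T R) : Prop :=
  forall (m : nat) (k : 'I_m -> nat)
    (Q : forall i : 'I_m, probability ((k i).-tuple R) R),
  exists X : forall i : 'I_m, {RV P >-> (k i).-tuple R},
    independent_vectors X /\
    forall (i : 'I_m) (A : set ((k i).-tuple R)), measurable A ->
      distribution P (X i) A = Q i A.

(* F^{-1}, extended-real-valued: quantile F 1 may be +oo (infimum of the
   empty set) and quantile F 0 may be -oo. *)
Definition quantile (R : realType) (F : R -> R) (t : R) : \bar R :=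
  if t == 0%R then ereal_inf [set x%:E | x in [set x : R | (0 < F x)%R]]
  else ereal_inf [set x%:E | x in [set x : R | (t <= F x)%R]].

Definition mu (R : realType) (F : R -> R) (p q : R) : \bar R :=
  ((q - p)^-1)%:E * \int[lebesgue_measure]_(t in `[p, q]) quantile F t.

Definition VaR d (T : measurableType d) (R : realType) (P : probability T R)
    (p : R) (X : {RV P >-> R}) : \bar R :=
  ereal_inf [set x%:E | x in [set x : R | p%:E <= cdf X x]].

Definition has_cdf d (T : measurableType d) (R : realType)
    (P : probability T R) (F : R -> R) (X : {RV P >-> R}) : Prop :=
  forall x : R, cdf X x = (F x)%:E.

(* The set S_n of sums of n random variables distributed as F, with
   arbitrary dependence. *)
Definition sums d (T : measurableType d) (R : realType)
    (P : probability T R) (F : R -> R) (n : nat) : set {RV P >-> R} :=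
  [set S : {RV P >-> R} | exists X : 'I_n -> {RV P >-> R},
     (forall i, has_cdf F (X i)) /\
     forall w, S w = (\sum_(i < n) X i w)%R].
Arguments sums {d T R} P F n.

(* When quantile F q = +oo the bound is read as -oo. *)
Definition sup_lower_bound (R : realType) (F : R -> R) (n : nat) (p q : R) :
    \bar R :=
  if quantile F q == +oo then -oo
  else n%:R%:E * mu F p q - (quantile F q - quantile F p).

(* When quantile F q = -oo the bound is read as +oo. *)
Definition inf_upper_bound (R : realType) (F : R -> R) (n : nat) (p q : R) :
    \bar R :=
  if quantile F q == -oo then +oo
  else n%:R%:E * mu F q p + (quantile F p - quantile F q).

Definition sup_VaR d (T : measurableType d) (R : realType)
    (P : probability T R) (F : R -> R) (n : nat) (p : R) : \bar R :=
  ereal_sup [set VaR p S | S in sums P F n].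

Definition inf_VaR d (T : measurableType d) (R : realType)
    (P : probability T R) (F : R -> R) (n : nat) (p : R) : \bar R :=
  ereal_inf [set VaR p S | S in sums P F n].

(* Main.v *)
(* Upper bound for the supremum: with c = F^{-1}(p) and S = X_1 + ... + X_n,
   S <= n c + sum_i (X_i - c)^+, so Markov's inequality bounds P(S > v) by
   n E(X - c)^+ / (v - n c), and E(X - c)^+ = (1 - p) (mu_{p,1} - c) because X
   has the law of F^{-1}(U) with U uniform on (0, 1).  The lower bound for the
   infimum is the same argument with (c - X_i)^+.

   For the other two bounds, let X_i = F^{-1}(U_i) where U_i is obtained from U
   by a rotation of (p, q] by i (q - p) / n, and by the identity outside (p, q].
   Each U_i is again uniform.  When U lies in (p, q], the U_i are the n points of
   a grid of mesh (q - p) / n in (p, q], so that X_1 + ... + X_n is, up to the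
   factor n, a Riemann sum of a monotone function with mean mu_{p,q}, and hence
   differs from n mu_{p,q} by at most F^{-1}(q) - F^{-1}(p). *)
From HB Require Import structures.
Require Import Defs.
From mathcomp Require Import measurable_realfun ring lra.

Set Implicit Arguments.
Unset Strict Implicit.
Unset Printing Implicit Defensive.

Local Open Scope classical_set_scope.
Local Open Scope ring_scope.

(** * Rotations of a half-open interval *)

Section Rotation.
Variable R : realType.
Implicit Types p q h u s a b : R.

Definition rotate p q h u : R :=
  if p < u <= q then if u + h <= q then u + h else u + h - (q - p) else u.

Lemma rotate_in p q h u : 0 <= h < q - p -> p < u <= q -> p < rotate p q h u <= q.
Proof. by move=> hpq upq; rewrite /rotate upq; case: (lerP (u + h) q) => ?; lra. Qed.

Lemma rotate_out p q h u : ~~ (p < u <= q) -> rotate p q h u = u.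
Proof. by rewrite /rotate => /negbTE ->. Qed.

(** This form makes the law of a rotated uniform variable computable. For [p <= s < q], if
    [s - h < p] no unwrapped point of [(p, q]] lands below [s] and only part of the wrapped ones do;
    otherwise all wrapped points do. *)
Lemma rotate_le p q h u s : 0 <= h < q - p ->
  (rotate p q h u <= s) =
  if s < p then u <= s else
  if q <= s then u <= s else
  if s - h < p then (u <= p) || (q - h < u <= s + (q - p) - h)
  else (u <= s - h) || (q - h < u <= q).
Proof.
move=> hpq; rewrite /rotate.
case: ifPn => [/andP[pu uq]|]; first case: ifPn; rewrite ?negb_and -?ltNge -?leNgt.
all: move=> *; apply/idP/idP; repeat case: ifPn; rewrite -?ltNge -?leNgt.
all: rewrite ?negb_and -?ltNge -?leNgt => *; lra.
Qed.

(** Cut [(p, q]] into [m.+1] cells of length [d]: [j] is the cell of [u] and [v] its translate in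
    the first cell. A rotation by [i * d] moves the cell index by [i] cyclically, so [j + i] is the
    sum in ['I_m.+1], modulo [m.+1]. *)
Lemma rotate_grid p q u (m : nat) (d := (q - p) / m.+1%:R) : p < u <= q ->
  exists (j : 'I_m.+1) (v : R), p < v <= p + d /\
    forall i : 'I_m.+1, rotate p q (i%:R * d) u = v + (j + i)%R%:R * d.
Proof.
move=> /andP[pu uq].
have m0 : (0 : R) < m.+1%:R by rewrite ltr0n.
have d0 : 0 < d by rewrite divr_gt0// subr_gt0 (lt_le_trans pu).
have dE : q - p = m.+1%:R * d by rewrite /d mulrCA divff ?mulr1// gt_eqF.
(* Take the least [j] satisfying the right-hand inequality; minimality gives the strict one on the
   left. *)
have [j [jm [jl jr]]] : exists j, (j < m.+1)%N /\ j%:R * d < u - p /\ u - p <= j.+1%:R * d.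
  have : exists k, u - p <= k.+1%:R * d by exists m; rewrite -dE; lra.
  move=> ex; case: (ex_minnP ex) => k uk kmin; exists k; split; last split => //.
    by rewrite ltnS kmin// -dE; lra.
  case: k uk kmin => [|k] uk kmin; first by rewrite mul0r; lra.
  by rewrite ltNge; apply/negP => /kmin; rewrite ltnn.
exists (Ordinal jm), (u - j%:R * d); split.
  by move: jr; rewrite -natr1 mulrDl mul1r => jr; apply/andP; split; lra.
move=> i; rewrite /rotate pu uq/=.
move: jr; rewrite -natr1 mulrDl mul1r => jr.
have [ji|ji] := ltnP (j + i) m.+1.
- rewrite modn_small// natrD mulrDl ifT; last first.
    have : (j + i).+1%:R * d <= m.+1%:R * d by rewrite ler_pM2r// ler_nat.
    by rewrite -dE -natr1 natrD !mulrDl mul1r; lra.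
  by ring.
- have jiE : ((j + i) %% m.+1 = j + i - m.+1)%N.
    rewrite -[in LHS](subnK ji) modnDr modn_small// ltn_subLR//.
    by rewrite -addnS leq_add// ltnW.
  rewrite jiE natrB// natrD mulrBl mulrDl -dE ifF; first by ring.
  have : m.+1%:R * d <= (j + i)%:R * d by rewrite ler_pM2r// ler_nat.
  by rewrite -dE natrD mulrDl => ?; apply/negbTE; rewrite -ltNge; lra.
Qed.

(** * Riemann sums of a monotone function on a shifted grid *)

Section RiemannSum.
Variables (p q a b : R) (g H : R -> R).
Hypothesis gab : forall x, p <= x <= q -> a <= g x <= b.
Hypothesis Hg : forall x y, p <= x -> x <= y -> y <= q ->
  g x * (y - x) <= H y - H x <= g y * (y - x).

(** [Hg] makes [H] a primitive of [g] without mentioning integrals. Between neighbouring grid points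
    the increment of [H] is at most [d] times the right-hand value of [g]. The two end pieces have
    total length [d] and contribute at most [b * d], while the first grid value, not consumed by the
    telescoping, is worth at least [a * d]. *)
Lemma grid_sum_lower (m : nat) (d := (q - p) / m.+1%:R) v :
  0 < d -> p < v <= p + d ->
  H q - H p - (b - a) * d <= (\sum_(i < m.+1) g (v + i%:R * d)) * d.
Proof.
move=> d0 /andP[pv vd].
have dE : q - p = m.+1%:R * d by rewrite /d mulrCA divff ?mulr1// pnatr_eq0.
have vm : v + m%:R * d <= q.
  by move: dE; rewrite -natr1 mulrDl mul1r; lra.
have pm k : p <= v + k%:R * d.
  by rewrite (le_trans (ltW pv))// lerDl mulr_ge0// ltW.
have lek k : (k <= m)%N -> v + k%:R * d <= q.
  by move=> km; apply: le_trans vm; rewrite lerD2l ler_pM2r// ler_nat.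
have tel k : (k <= m)%N ->
    H (v + k%:R * d) - H v <= (\sum_(i < k) g (v + i.+1%:R * d)) * d.
  elim: k => [_|k IH km]; first by rewrite big_ord0 mul0r addr0 subrr.
  rewrite big_ord_recr/= mulrDl.
  have vk : v + k%:R * d <= v + k.+1%:R * d by rewrite lerD2l ler_pM2r// ler_nat.
  have /andP[_] := Hg (pm k) vk (lek _ km).
  have -> : v + k.+1%:R * d - (v + k%:R * d) = d by rewrite -natr1; ring.
  by have := IH (ltnW km); lra.
rewrite big_ord_recl [leRHS]mulrDl mul0r addr0.
under eq_bigr do rewrite lift0.
have vq : v <= q by have := lek 0%N isT; rewrite mul0r addr0.
have /andP[_ H1] := Hg (lexx p) (ltW pv) vq.
have /andP[_ H2] := Hg (pm m) vm (lexx q).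
have /andP[av vb] := gab (introT andP (conj (ltW pv) vq)).
have /andP[_ qb] : a <= g q <= b by apply: gab; rewrite lexx (le_trans (ltW pv)).
have := tel m (leqnn m).
have e1 : g v * (v - p) <= b * (v - p) by apply: ler_wpM2r => //; lra.
have e2 : g q * (q - (v + m%:R * d)) <= b * (q - (v + m%:R * d)).
  by apply: ler_wpM2r => //; lra.
have e3 : a * d <= g v * d by rewrite ler_pM2r.
have e4 : b * (v - p) + b * (q - (v + m%:R * d)) = b * d.
  by rewrite -mulrDr; congr (_ * _); move: dE; rewrite -natr1 mulrDl mul1r; lra.
by rewrite mulrBl; lra.
Qed.

(** Mirror argument with left-hand values: the last grid value is left over and is at most [b], and
    [g] is at least [a] on the end pieces. *)
Lemma grid_sum_upper (m : nat) (d := (q - p) / m.+1%:R) v :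
  0 < d -> p < v <= p + d ->
  (\sum_(i < m.+1) g (v + i%:R * d)) * d <= H q - H p + (b - a) * d.
Proof.
move=> d0 /andP[pv vd].
have dE : q - p = m.+1%:R * d by rewrite /d mulrCA divff ?mulr1// pnatr_eq0.
have vm : v + m%:R * d <= q.
  by move: dE; rewrite -natr1 mulrDl mul1r; lra.
have pm k : p <= v + k%:R * d.
  by rewrite (le_trans (ltW pv))// lerDl mulr_ge0// ltW.
have lek k : (k <= m)%N -> v + k%:R * d <= q.
  by move=> km; apply: le_trans vm; rewrite lerD2l ler_pM2r// ler_nat.
have tel k : (k <= m)%N ->
    (\sum_(i < k) g (v + i%:R * d)) * d <= H (v + k%:R * d) - H v.
  elim: k => [_|k IH km]; first by rewrite big_ord0 !mul0r addr0 subrr.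
  rewrite big_ord_recr/= mulrDl.
  have vk : v + k%:R * d <= v + k.+1%:R * d by rewrite lerD2l ler_pM2r// ler_nat.
  have /andP[+ _] := Hg (pm k) vk (lek _ km).
  have -> : v + k.+1%:R * d - (v + k%:R * d) = d by rewrite -natr1; ring.
  by have := IH (ltnW km); lra.
rewrite big_ord_recr/= [leLHS]mulrDl.
have vq : v <= q by have := lek 0%N isT; rewrite mul0r addr0.
have /andP[H1 _] := Hg (lexx p) (ltW pv) vq.
have /andP[H2 _] := Hg (pm m) vm (lexx q).
have /andP[av vb] := gab (introT andP (conj (pm m) vm)).
have /andP[ap _] : a <= g p <= b by apply: gab; rewrite lexx (le_trans (ltW pv)).
have := tel m (leqnn m).
set w := v + m%:R * d in vm av vb H2 *.
have e1 : a * (v - p) <= g p * (v - p) by apply: ler_wpM2r => //; lra.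
have e2 : a * (q - w) <= g w * (q - w) by apply: ler_wpM2r => //; lra.
have e3 : g w * d <= b * d by rewrite ler_pM2r.
have e4 : a * (v - p) + a * (q - w) = a * d.
  by rewrite -mulrDr; congr (_ * _); move: dE; rewrite /w -natr1 mulrDl mul1r; lra.
by rewrite mulrBl; lra.
Qed.

End RiemannSum.
End Rotation.

Local Open Scope ereal_scope.

(** * Order properties of the quantile function *)

Section Quantile.
Variables (R : realType) (F : cumulativeBounded (0 : R)%R (1 : R)%R).

Lemma cumulative_ge0 (x : R) : (0 <= F x)%R.
Proof.
rewrite -lee_fin -(cdf_lebesgue_stieltjes_id F); exact: cdf_ge0.
Qed.

Lemma cumulative_le1 (x : R) : (F x <= 1)%R.
Proof.
rewrite -lee_fin -(cdf_lebesgue_stieltjes_id F); exact: cdf_le1.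
Qed.

(** Galois connection between [F] and its quantile. Right continuity of [F] carries [t <= F y] for
    all [y > x] over to [x] itself. *)
Lemma quantile_leE (t x : R) : (0 < t)%R -> (quantile F t <= x%:E) = (t <= F x)%R.
Proof.
move=> t0; rewrite /quantile gt_eqF//; apply/idP/idP => [tx|tx]; last first.
  by apply: ereal_inf_lbound; exists x.
have right_cvg := cumulative_is_right_continuous F x.
apply: (cvgr_to_ge right_cvg); near=> y.
have xy : x%:E < y%:E by rewrite lte_fin; near: y; exact: nbhs_right_gt.
have /ereal_inf_lt[_ [z /= tz <-]] := le_lt_trans tx xy.
rewrite lte_fin => zy.
by apply: le_trans tz _; apply: cumulative_is_nondecreasing; exact: ltW.
Unshelve. all: by end_near. Qed.

Lemma quantile_ltE (t x : R) : (0 < t)%R -> (x%:E < quantile F t) = (F x < t)%R.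
Proof. by move=> t0; rewrite !ltNge quantile_leE. Qed.

Lemma quantile_nondecreasing (s t : R) :
  (0 <= s)%R -> (s <= t)%R -> quantile F s <= quantile F t.
Proof.
move=> s0 st; rewrite /quantile.
have [s_eq0|sn0] := eqVneq s 0%R; case: (eqVneq t 0%R) => [t_eq0|tn0] //.
- apply: ereal_inf_le_tmp => _ [x /= tx <-]; exists x => //=.
  by rewrite (lt_le_trans _ tx)// lt_neqAle eq_sym tn0 (le_trans s0).
- by case/eqP: sn0; apply/le_anti; rewrite s0 -t_eq0 st.
- by apply: ereal_inf_le_tmp => _ [x /= tx <-]; exists x => //=; exact: le_trans tx.
Qed.

Lemma quantile_gtNy (t : R) : (0 < t)%R -> -oo < quantile F t.
Proof.
move=> t0; have [x xt] : exists x, (F x < t)%R.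
  have := cvgr_lt _ (cumulativeNy F) t t0.
  by move=> /(_ _) /filter_ex[x]; exists x.
by apply: lt_trans (ltNyr x) _; rewrite quantile_ltE.
Qed.

Lemma quantile_lty (t : R) : (t < 1)%R -> quantile F t < +oo.
Proof.
move=> t1; have [x xt] : exists x, (Num.max t 2^-1 < F x)%R.
  (* The maximum with [2^-1] forces [0 < F x] when [t <= 0], which covers the separate definition of
     the quantile at [0]. *)
  have := cvgr_gt _ (cumulativey F) (Num.max t 2^-1)%R.
  have h1 : (Num.max t 2^-1 < 1 :> R)%R by rewrite gt_max t1; lra.
  by move=> /(_ _ h1) /filter_ex[x]; exists x.
apply: le_lt_trans (ltry x).
have := xt; rewrite gt_max => /andP[tx x2].
have [t0|t0] := ltP 0%R t; first by rewrite quantile_leE// ltW.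
rewrite /quantile; case: ifP => _; apply: ereal_inf_lbound; exists x => //=; lra.
Qed.

Lemma quantile_fin_num (t : R) : (0 < t < 1)%R -> quantile F t \is a fin_num.
Proof.
by move=> /andP[t0 t1]; rewrite fin_real// quantile_gtNy// quantile_lty.
Qed.

Lemma measurable_quantile : measurable_fun (`](0 : R)%R, (1 : R)%R]%classic : set R) (quantile F).
Proof.
apply: (measurability (@ErealGenOInfty.G R)) => [|/= _ [_] [r] -> <-].
  exact: ErealGenOInfty.measurableE.
rewrite (_ : _ `&` _ = `](0 : R)%R, (1 : R)%R]%classic `&` `]F r, +oo[%classic).
  exact: measurableI.
apply/seteqP; split => t /=; rewrite !in_itv/= !andbT => -[/andP[t0 t1]];
  by rewrite quantile_ltE// t0 t1.
Qed.

(** Left continuity of the quantile: by the Galois connection [s = F c] works. *)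
Lemma quantile_left_approx (p c : R) : (0 < p)%R -> c%:E < quantile F p ->
  exists2 s, (0 <= s < p)%R & forall t, (s < t)%R -> c%:E < quantile F t.
Proof.
move=> p0; rewrite quantile_ltE// => cp; exists (F c).
  by rewrite cumulative_ge0.
move=> t ct; rewrite quantile_ltE//.
exact: le_lt_trans (cumulative_ge0 c) ct.
Qed.

End Quantile.

(** * A primitive of the quantile function *)

Section QuantilePrimitive.
Variables (R : realType) (F : cumulativeBounded (0 : R)%R (1 : R)%R).
Local Notation g := (fun t => fine (quantile F t)).

Lemma measurable_quantile01 : measurable_fun (`[(0 : R)%R, (1 : R)%R]%classic : set R) (quantile F).
Proof. exact: (emeasurable_fun_itv_obnd_cbndP _ _ _).1 (measurable_quantile F). Qed.

Lemma quantile_finite (p q t : R) : (0 <= p)%R -> -oo < quantile F p ->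
  quantile F q < +oo -> (p <= t <= q)%R -> quantile F t \is a fin_num.
Proof.
move=> p0 pNy qy /andP[pt tq]; apply: fin_real.
rewrite (lt_le_trans pNy) ?quantile_nondecreasing//=.
by rewrite (le_lt_trans _ qy)// quantile_nondecreasing// (le_trans p0).
Qed.

Lemma fine_quantile_le (p q s t : R) : (0 <= p)%R -> -oo < quantile F p ->
  quantile F q < +oo -> (p <= s)%R -> (s <= t)%R -> (t <= q)%R -> (g s <= g t)%R.
Proof.
move=> p0 pNy qy ps st tq; apply: fine_le.
- by apply: (quantile_finite p0 pNy qy); rewrite ps (le_trans st).
- by apply: (quantile_finite p0 pNy qy); rewrite tq (le_trans ps).
- by apply: quantile_nondecreasing => //; exact: le_trans ps.
Qed.

(** Finite quantiles at [p] and [q] make [g] bounded and monotone on [[p, q]], hence integrable, and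
    [H] is its integral from [p]. The first conjunct is the hypothesis of the grid estimates; one
    [H] serves every subinterval. *)
Lemma quantile_primitive (p q : R) : (0 <= p)%R -> (q <= 1)%R ->
    -oo < quantile F p -> quantile F q < +oo ->
  exists H : R -> R,
    (forall x y, p <= x -> x <= y -> y <= q ->
      g x * (y - x) <= H y - H x <= g y * (y - x))%R /\
    (forall x y, (p <= x)%R -> (x < y)%R -> (y <= q)%R ->
      mu F x y = ((H y - H x) / (y - x))%:E).
Proof.
move=> p0 q1 pNy qy.
have fin := quantile_finite p0 pNy qy.
have mono := fine_quantile_le p0 pNy qy.
have mg x y : (p <= x)%R -> (y <= q)%R -> measurable_fun (`[x, y]%classic : set R) g.
  move=> px yq; apply: measurableT_comp => //.
  apply: measurable_funS measurable_quantile01 => // t /=; rewrite !in_itv/= => txy; lra.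
have ig x y : (p <= x)%R -> (y <= q)%R ->
    (@lebesgue_measure R).-integrable `[x, y] (EFin \o g).
  move=> px yq; apply: measurable_bounded_integrable => //.
  - exact: compact_finite_measure (@segment_compact R x y).
  - exact: mg.
  - exists (`|g x| + `|g y|)%R; split; first exact: num_real.
    move=> M gM t /=; rewrite in_itv/= => /andP[xt ty].
    apply: le_trans (ltW gM).
    have h1 : (g x <= g t)%R by apply: mono => //; exact: le_trans yq.
    have h2 : (g t <= g y)%R by apply: mono => //; exact: le_trans xt.
    by rewrite ler_norml; have := ler_norm (g y); have := ler_norm (- g x);
       rewrite normrN; have := normr_ge0 (g x); have := normr_ge0 (g y); lra.
exists (fun x => \int[lebesgue_measure]_(t in `[p, x]) g t)%R.
have HB x y : (p <= x)%R -> (x <= y)%R -> (y <= q)%R ->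
   (\int[lebesgue_measure]_(t in `[p, y]) g t - \int[lebesgue_measure]_(t in `[p, x]) g t =
    \int[lebesgue_measure]_(t in `[x, y]) g t)%R.
  move=> px xy yq; rewrite Rintegral_itvB//; last exact: ig.
  rewrite Rintegral_itv_obnd_cbnd//.
  apply: integrableS (ig x y px yq) => //.
  by move=> t /=; rewrite !in_itv/= => /andP[/ltW -> ->].
split=> [x y px xy yq|x y px xy yq].
- rewrite HB//.
  have cstE (c : R) : (\int[lebesgue_measure]_(t in `[x, y]) c = c * (y - x))%R.
    rewrite Rintegral_cst//= lebesgue_measure_itv/= lte_fin.
    have [//|xy'] := ltP x y.
    have ->: x = y by apply/le_anti; rewrite xy xy'.
    by rewrite subrr.
  have icst (c : R) : (@lebesgue_measure R).-integrable `[x, y] (EFin \o cst c).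
    apply: measurable_bounded_integrable => //.
      exact: compact_finite_measure (@segment_compact R x y).
    by exists `|c|%R; split; [exact: num_real|move=> M cM t _; exact: ltW].
  rewrite -!cstE; apply/andP; split; apply: le_Rintegral => //; try solve [exact: ig|exact: icst].
  + by move=> t /=; rewrite in_itv/= => /andP[xt ty]; apply: mono => //; exact: le_trans yq.
  + by move=> t /=; rewrite in_itv/= => /andP[xt ty]; apply: mono => //; exact: le_trans xt.
- rewrite HB// ?(ltW xy)// /mu /Rintegral mulrC EFinM fineK; last first.
    by apply: integrable_fin_num => //; exact: ig.
  congr (_ * _); apply: eq_integral => t; rewrite inE/= in_itv/= => /andP[xt ty].
  by rewrite fineK// fin// (le_trans px)// (le_trans ty).
Qed.

End QuantilePrimitive.

(** * Uniform random variables and their rotations *)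

Section RandomVariables.
Context (R : realType) (d : measure_display) (T : measurableType d)
  (P : probability T R).

Lemma RV_of_measurable (X : T -> R) : measurable_fun setT X ->
  exists Y : {RV P >-> R}, forall w, Y w = X w.
Proof.
move=> mX; pose mX' := isMeasurableFun.Build _ _ _ _ X mX.
pose Y : {mfun T >-> R} := HB.pack X mX'.
by exists Y.
Qed.

Lemma measurable_fun_rays (X : T -> R) :
  (forall x, measurable [set w | (X w <= x)%R]) -> measurable_fun setT X.
Proof.
move=> mX; apply: (measurability (@RGenOInfty.G R)) => [|/= _ [_] [r] -> <-].
  exact: RGenOInfty.measurableE.
rewrite setTI (_ : _ @^-1` _ = ~` [set w | (X w <= r)%R]); first exact: measurableC.
by apply/seteqP; split => w /=; rewrite in_itv/= andbT ltNge => /negP.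
Qed.

Lemma cdfE (X : {RV P >-> R}) (x : R) : cdf X x = P [set w | (X w <= x)%R].
Proof.
rewrite /cdf /distribution /pushforward; congr (P _).
Qed.

Lemma measurable_RV_le (X : {RV P >-> R}) (x : R) :
  measurable [set w | (X w <= x)%R].
Proof.
have : measurable (X @^-1` `]-oo, x]) by exact: measurable_funPTI.
by congr measurable; apply/seteqP; split => w /=; rewrite in_itv.
Qed.

Lemma measurable_RV_itv (X : {RV P >-> R}) (a b : R) :
  measurable [set w | (a < X w <= b)%R].
Proof.
rewrite (_ : mkset _ = [set w | (X w <= b)%R] `\` [set w | (X w <= a)%R]).
  by apply: measurableD; exact: measurable_RV_le.
apply/seteqP; split => w /=; first by rewrite ltNge => /andP[/negP ? ?].
by rewrite ltNge => -[-> /negP ->].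
Qed.

Lemma uniform_prob01_ray (s : R) : (0 <= s <= 1)%R ->
  uniform_prob (@ltr01 R) `]-oo, s] = s%:E.
Proof.
move=> /andP[s0 s1]; rewrite /uniform_prob integral_uniform_pdf.
have -> : `]-oo, s] `&` `[(0 : R)%R, (1 : R)%R] = `[(0 : R)%R, s]%classic.
  by apply/seteqP; split => x /=; rewrite !in_itv/=; [case=> ? ?|move=> ?; split]; lra.
rewrite (eq_integral (cst 1)); last first.
  move=> x; rewrite inE/= in_itv/= => /andP[x0 xs].
  by rewrite /uniform_pdf x0 (le_trans xs s1)/= subr0 invr1.
rewrite integral_cst//= mul1e lebesgue_measure_itv/= lte_fin.
by case: ltP => [_|s0']; [rewrite sube0|congr EFin; apply/le_anti/andP].
Qed.

Lemma uniform_prob01_setC :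
  uniform_prob (@ltr01 R) (~` `](0 : R)%R, (1 : R)%R[%classic) = 0.
Proof.
have U01 : uniform_prob (@ltr01 R) `](0 : R)%R, (1 : R)%R[%classic = 1.
  rewrite -(integral_uniform_pdf1 (@ltr01 R) (@subset_refl _ `[(0 : R)%R, (1 : R)%R]%classic)).
  rewrite integral_itv_bndoo//; apply/measurable_EFinP/measurable_funTS.
  exact: measurable_uniform_pdf.
have := @probability_setC _ _ _ (uniform_prob (@ltr01 R)) `](0 : R)%R, (1 : R)%R[%classic (measurable_itv _).
by rewrite [in X in _ = X -> _]/= U01 subee.
Qed.

(** A single vector of length one with uniform law suffices. It is then modified on a null set so
    that [U] lies in the open interval everywhere, where the quantile is finite. *)
Lemma exists_uniform : generates_independent_vectors P ->
  exists U : {RV P >-> R}, (forall w, (0 < U w < 1)%R) /\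
    forall s : R, (0 <= s <= 1)%R -> cdf U s = s%:E.
Proof.
move=> rich.
have mtup : measurable_fun setT (fun x : measurableTypeR R => [tuple x] : 1.-tuple R).
  apply/measurable_fun_tnthP => i.
  by rewrite (_ : _ \o _ = id)//; apply/funext => x /=; rewrite (ord1 i).
pose mtup' := isMeasurableFun.Build _ _ _ _ _ mtup.
pose tup : {mfun measurableTypeR R >-> 1.-tuple R} := HB.pack (fun x : measurableTypeR R => [tuple x]) mtup'.
pose Q : probability (1.-tuple R) R := distribution (uniform_prob (@ltr01 R)) tup.
have [X [_ XQ]] := rich 1%N (fun=> 1%N) (fun=> Q).
pose V w := tnth (X ord0 w) ord0.
have PV (A : set R) : measurable A -> P (V @^-1` A) = uniform_prob (@ltr01 R) A.
  move=> mA; have := XQ ord0 ((fun t => tnth t ord0) @^-1` A).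
  have mtA : measurable ((fun t : 1.-tuple R => tnth t ord0) @^-1` A).
    by rewrite -[X in measurable X]setTI; exact: (measurable_tnth ord0).
  move=> /(_ mtA); rewrite /distribution /pushforward -comp_preimage => ->.
  by rewrite /Q /distribution /pushforward -comp_preimage.
have mV : measurable_fun setT V.
  apply: (measurableT_comp (measurable_tnth ord0)) => //.
pose I : set R := `](0 : R)%R, (1 : R)%R[%classic.
pose B := V @^-1` (~` I).
have mVA (A : set R) : measurable A -> measurable (V @^-1` A).
  by move=> mA; rewrite -[X in measurable X]setTI; exact: mV.
have mB : measurable B by apply: mVA; apply: measurableC; exact: measurable_itv.
have B0 : P B = 0.
  rewrite PV; first exact: uniform_prob01_setC.
  by apply: measurableC; exact: measurable_itv.
(* The value [2^-1] is arbitrary in [(0, 1)]; it is taken only on the null set [B]. *)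
pose W w := (if 0 < V w < 1 then V w else 2^-1)%R.
have mW : measurable_fun setT W.
  apply: measurable_fun_if => //=.
  - by apply: measurable_and; apply: measurable_fun_ltr.
  - exact: measurable_funTS.
have [U UE] := RV_of_measurable mW.
exists U; split=> [w|s s01].
  by rewrite UE /W; case: ifPn => // _; lra.
rewrite cdfE -(uniform_prob01_ray s01) -PV//.
have mVs : measurable (V @^-1` `]-oo, s]) by exact: mVA.
have BP w : ~ B w -> U w = V w.
  by rewrite UE /W /B/= => /contrapT; rewrite /I/= in_itv/= => ->.
apply/le_anti/andP; split.
- rewrite -(measureU0 mVs mB B0); apply: le_measure; rewrite ?inE//.
  + exact: measurable_RV_le.
  + exact: measurableU.
  + move=> w /= Us; have [|nB] := pselect (B w); first by right.
    by left; rewrite /= in_itv/= -(BP w nB).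
- rewrite -(measureU0 (measurable_RV_le U s) mB B0); apply: le_measure; rewrite ?inE//.
  + by apply: measurableU => //; exact: measurable_RV_le.
  + move=> w /= Us; have [|nB] := pselect (B w); first by right.
    by left => /=; move: Us; rewrite in_itv/= -(BP w nB).
Qed.

Lemma probability_itv_oc (U : {RV P >-> R}) (a b : R) :
  (forall s : R, (0 <= s <= 1)%R -> cdf U s = s%:E) ->
  (0 <= a)%R -> (a <= b)%R -> (b <= 1)%R ->
  P [set w | (a < U w <= b)%R] = (b - a)%:E.
Proof.
move=> Uunif a0 ab b1.
have a01 : (0 <= a <= 1)%R by rewrite a0 (le_trans ab).
have b01 : (0 <= b <= 1)%R by rewrite b1 (le_trans a0).
have Pa : P [set w | (U w <= a)%R] = a%:E by rewrite -cdfE Uunif.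
have Pb : P [set w | (U w <= b)%R] = b%:E by rewrite -cdfE Uunif.
have PU : P [set w | (U w <= b)%R] =
    P [set w | (U w <= a)%R] + P [set w | (a < U w <= b)%R].
  rewrite -measureU//; last 3 first.
  - exact: measurable_RV_le.
  - exact: measurable_RV_itv.
  - by apply/seteqP; split => w //= [] Ua /andP[]; rewrite ltNge Ua.
  congr (P _); apply/seteqP; split => w /= => [Ub|[Ua|/andP[]//]]; last exact: le_trans ab.
  by rewrite Ub andbT; case: (leP (U w) a) => ?; [left|right].
have : P [set w | (a < U w <= b)%R] \is a fin_num.
  by apply: fin_num_measure; exact: measurable_RV_itv.
move: PU; rewrite Pa Pb EFinB => ->; move: (P _) => x xfin.
by rewrite addeAC subee// add0e.
Qed.

(** A rotation preserves Lebesgue measure: each sublevel set from [rotate_le] is a union of disjoint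
    intervals of total length [s]. *)
Lemma cdf_rotate (U V : {RV P >-> R}) (p q h : R) :
  (forall s : R, (0 <= s <= 1)%R -> cdf U s = s%:E) ->
  (0 <= p)%R -> (p < q)%R -> (q <= 1)%R -> (0 <= h < q - p)%R ->
  (forall w, V w = rotate p q h (U w)) ->
  forall s : R, (0 <= s <= 1)%R -> cdf V s = s%:E.
Proof.
move=> Uunif p0 pq q1 hpq VE s s01; rewrite cdfE.
have VsE : [set w | (V w <= s)%R] = [set w | if (s < p)%R then (U w <= s)%R else
  if (q <= s)%R then (U w <= s)%R else
  if (s - h < p)%R then (U w <= p)%R || (q - h < U w <= s + (q - p) - h)%R
  else (U w <= s - h)%R || (q - h < U w <= q)%R].
  by apply/seteqP; split => w /=; rewrite VE rotate_le.
rewrite {}VsE.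
(* Both cases with [p <= s < q] have this shape. *)
have key a b c : (0 <= a)%R -> (a <= b)%R -> (b <= c)%R -> (c <= 1)%R ->
    P [set w | (U w <= a)%R || (b < U w <= c)%R] = (a + (c - b))%:E.
  move=> a0 ab bc c1.
  have -> : P [set w | (U w <= a)%R || (b < U w <= c)%R] =
      P [set w | (U w <= a)%R] + P [set w | (b < U w <= c)%R].
    rewrite -measureU//; last 3 first.
    - exact: measurable_RV_le.
    - exact: measurable_RV_itv.
    - apply/seteqP; split => w //= [] Ua /andP[bU _]; lra.
    by congr (P _); apply/seteqP; split => w /= /orP.
  by rewrite -cdfE Uunif ?probability_itv_oc//; lra.
case: (ltP s p) => sp; first by rewrite -cdfE Uunif.
case: (leP q s) => qs; first by rewrite -cdfE Uunif.
case: (ltP (s - h)%R p) => sh; rewrite key; try (congr EFin); lra.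
Qed.

Lemma measurable_rotate (p q h : R) : measurable_fun setT (rotate p q h).
Proof.
apply: measurable_fun_ifT => //=.
  by apply: measurable_and; [exact: measurable_fun_ltr|exact: measurable_fun_ler].
apply: measurable_fun_ifT => //=.
- by apply: measurable_fun_ler => //; exact: measurable_funD.
- exact: measurable_funD.
- by do 2 apply: measurable_funD => //.
Qed.

End RandomVariables.

(** * Sums of quantiles of rotated uniforms *)

Section RotatedSums.
Context (R : realType) (d : measure_display) (T : measurableType d)
  (P : probability T R) (F : cumulativeBounded (0 : R)%R (1 : R)%R).
Local Notation g := (fun t => fine (quantile F t)).

(** Inverse transform: the sublevel sets of [g (V w)] are those of [V] at level [F x], which yields
    both measurability and the cdf. *)
Lemma quantile_transform (V : {RV P >-> R}) :
  (forall w, (0 < V w)%R) -> (forall w, quantile F (V w) \is a fin_num) ->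
  (forall s : R, (0 <= s <= 1)%R -> cdf V s = s%:E) ->
  exists2 X : {RV P >-> R}, (forall w, X w = g (V w)) & has_cdf F X.
Proof.
move=> V0 Vfin Vunif.
have leE x : [set w | (g (V w) <= x)%R] = [set w | (V w <= F x)%R].
  by apply/seteqP; split => w /=; rewrite -quantile_leE// -[X in X <= _]fineK// lee_fin.
have [X XE] : exists X : {RV P >-> R}, forall w, X w = g (V w).
  apply: RV_of_measurable; apply: measurable_fun_rays => x.
  by rewrite leE; exact: measurable_RV_le.
exists X => // x; rewrite cdfE.
have -> : [set w | (X w <= x)%R] = [set w | (V w <= F x)%R].
  by rewrite -leE; apply/seteqP; split => w /=; rewrite XE.
by rewrite -cdfE Vunif// cumulative_ge0 cumulative_le1.
Qed.

(** For [U] in [(p, q]] the grid estimates give both bounds. Elsewhere all summands equal [g (U w)],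
    and [g p <= m <= g q] with monotonicity gives the lower bound above [q] and the upper bound
    below [p]. *)
Lemma rotated_sum (p q m : R) (n : nat) :
  generates_independent_vectors P ->
  (0 <= p)%R -> (p < q)%R -> (q <= 1)%R ->
  -oo < quantile F p -> quantile F q < +oo -> mu F p q = m%:E ->
  exists U S : {RV P >-> R}, [/\ forall s : R, (0 <= s <= 1)%R -> cdf U s = s%:E,
    sums P F n S,
    forall w, (p < U w)%R -> (n%:R * m - (g q - g p) <= S w)%R &
    forall w, (U w <= q)%R -> (S w <= n%:R * m + (g q - g p))%R].
Proof.
move=> rich p0 pq q1 pNy qy muE.
have [U [U01 Uunif]] := exists_uniform rich.
have mono := fine_quantile_le p0 pNy qy.
have gpq : (g p <= g q)%R by apply: mono => //; exact: ltW.
have [H [Hg Hmu]] := quantile_primitive p0 q1 pNy qy.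
have mE : (m * (q - p) = H q - H p)%R.
  move: muE; rewrite Hmu// => -[<-]; rewrite divfK//; lra.
have /andP[] := Hg p q (lexx p) (ltW pq) (lexx q).
rewrite -mE !ler_pM2r ?subr_gt0// => gpm mgq.
(* The empty sum is treated apart, since the mesh [(q - p) / n] needs a positive [n]. *)
case: n => [|n].
  have [S SE] : exists S : {RV P >-> R}, forall w, S w = 0%R.
    by apply: RV_of_measurable; exact: measurable_cst.
  exists U, S; split => //.
  - have [S0 _ S0cdf] : exists2 X : {RV P >-> R}, (forall w, X w = g (U w)) & has_cdf F X.
      apply: quantile_transform => // w; first by have /andP[] := U01 w.
      exact: quantile_fin_num.
    by exists (fun=> S0); split => // w; rewrite big_ord0.
  - by move=> w _; rewrite SE mul0r; lra.
  - by move=> w _; rewrite SE mul0r; lra.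
pose D := ((q - p) / n.+1%:R)%R.
have D0 : (0 < D)%R by rewrite divr_gt0// ?subr_gt0// ltr0n.
have DE : (n.+1%:R * D = q - p)%R by rewrite /D mulrCA divff ?mulr1// pnatr_eq0.
have hi (i : 'I_n.+1) : (0 <= i%:R * D < q - p)%R.
  apply/andP; split; first by rewrite mulr_ge0// ltW.
  by rewrite -DE ltr_pM2r// ltr_nat.
have exX (i : 'I_n.+1) : exists X : {RV P >-> R},
    (forall w, X w = g (rotate p q (i%:R * D) (U w))) /\ has_cdf F X.
  have [V VE] : exists V : {RV P >-> R}, forall w, V w = rotate p q (i%:R * D) (U w).
    apply: RV_of_measurable.
    by apply: measurableT_comp; [exact: measurable_rotate|exact: measurable_funPT].
  have [X XE Xcdf] : exists2 X : {RV P >-> R}, (forall w, X w = g (V w)) & has_cdf F X.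
    apply: quantile_transform => [w|w|]; last exact: cdf_rotate VE.
    - rewrite VE; case: (boolP (p < U w <= q)%R) => [Upq|Upq].
        by have := rotate_in (hi i) Upq; lra.
      by rewrite rotate_out//; have /andP[] := U01 w.
    (* A rotated value may equal [q], possibly [1], so finiteness inside [(p, q]] comes from the
       endpoint hypotheses rather than from lying in [(0, 1)]. *)
    - rewrite VE; case: (boolP (p < U w <= q)%R) => [Upq|Upq].
        apply: (quantile_finite p0 pNy qy).
        by have := rotate_in (hi i) Upq; lra.
      by rewrite rotate_out// quantile_fin_num.
  by exists X; split=> // w; rewrite XE VE.
have [X XP] := choice exX.
have [S SE] : exists S : {RV P >-> R}, forall w, S w = (\sum_(i < n.+1) X i w)%R.
  by apply: RV_of_measurable; apply: measurable_sum => i; exact: measurable_funPT.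
have gab t : (p <= t <= q)%R -> (g p <= g t <= g q)%R.
  by move=> /andP[pt tq]; rewrite !mono.
have inside w : (p < U w <= q)%R ->
    (n.+1%:R * m - (g q - g p) <= S w <= n.+1%:R * m + (g q - g p))%R.
  move=> Upq; have [j [v [vp vE]]] := rotate_grid n Upq.
  have {}SE : S w = (\sum_(i < n.+1) g (v + i%:R * D))%R.
    rewrite SE (eq_bigr (fun i : 'I_n.+1 => g (v + (j + i)%R%:R * D)%R)); last first.
      by move=> i _; have [-> _] := XP i; rewrite vE.
    (* Cyclic translation by [j] permutes the indices, so the sum runs over the whole grid whichever
       cell contains [U w]. *)
    by rewrite [RHS](reindex_inj (addrI j)).
  have HE : (H q - H p = n.+1%:R * m * D)%R by rewrite -mE -DE; ring.
  have := grid_sum_lower gab Hg D0 vp; have := grid_sum_upper gab Hg D0 vp.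
  by rewrite HE -mulrBl -mulrDl !ler_pM2r// SE => -> ->.
have outside w : ~~ (p < U w <= q)%R -> S w = (n.+1%:R * g (U w))%R.
  move=> Upq; rewrite SE (eq_bigr (fun=> g (U w))); last first.
    by move=> i _; have [-> _] := XP i; rewrite rotate_out.
  by rewrite sumr_const card_ord mulr_natl.
exists U, S; split => //.
- by exists X; split => // i; have [] := XP i.
- move=> w pU; have [Uq|qU] := leP (U w) q.
    by have /andP[] := inside w (introT andP (conj pU Uq)).
  rewrite outside ?pU/= -?ltNge//.
  have /andP[U0 U1] := U01 w.
  have gqU : (g q <= g (U w))%R.
    by apply: (fine_quantile_le p0 pNy (quantile_lty F U1)) => //; exact: ltW.
  have : (n.+1%:R * m <= n.+1%:R * g (U w))%R.
    by rewrite ler_pM2l ?ltr0n// (le_trans mgq).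
  lra.
- move=> w Uq; have [Up|pU] := leP (U w) p; last first.
    by have /andP[] := inside w (introT andP (conj pU Uq)).
  rewrite outside ?(le_gtF Up)//.
  have /andP[U0 U1] := U01 w.
  have gUp : (g (U w) <= g p)%R.
    by apply: (fine_quantile_le (ltW U0) (quantile_gtNy F U0) qy) => //; exact: ltW.
  have : (n.+1%:R * g (U w) <= n.+1%:R * m)%R.
    by rewrite ler_pM2l ?ltr0n// (le_trans gUp).
  lra.
Qed.

End RotatedSums.

(** * Integrals of a nonnegative function plus a constant *)

Section IntegralShift.
Context d (T : measurableType d) (R : realType)
  (nu : {measure set T -> \bar R}) (D : set T) (m : R).
Hypotheses (mD : measurable D) (nuD : nu D = m%:E).
Variables (f : T -> R) (c : R).
Hypotheses (mf : measurable_fun D f) (f0 : forall x, D x -> (0 <= f x)%R).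

(** Since [f] is nonnegative, the negative part of [f + c] is at most [|c|], and [D] has finite
    measure. *)
Lemma integral_shift_funeneg :
  \int[nu]_(x in D) (fun y => (f y + c)%:E)^\- x \is a fin_num.
Proof.
have mh : measurable_fun D (fun y => (f y + c)%:E).
  by apply/measurable_EFinP; exact: measurable_funD.
rewrite ge0_fin_numE; last by apply: integral_ge0 => x _.
apply: (@le_lt_trans _ _ (\int[nu]_(x in D) (cst `|c|%:E) x)).
  apply: ge0_le_integral => //.
  - exact: measurable_funeneg.
  - move=> x Dx; rewrite funenegE -EFinN -EFin_max lee_fin ge_max normr_ge0 andbT.
    by have := f0 Dx; have := ler_norm (- c); rewrite normrN; lra.
by rewrite integral_cst// nuD -EFinM ltry.
Qed.

(* Splitting [f + c] and [c] into positive and negative parts turns this into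
   additivity of the integral of nonnegative functions, so that the integral
   of [f] may be infinite. *)
Lemma ge0_integral_shift :
  \int[nu]_(x in D) (f x + c)%:E = \int[nu]_(x in D) (f x)%:E + (c * m)%:E.
Proof.
have mh : measurable_fun D (fun y => (f y + c)%:E).
  by apply/measurable_EFinP; exact: measurable_funD.
have mfE : measurable_fun D (fun y => (f y)%:E) by exact/measurable_EFinP.
have f0E x : D x -> 0 <= (f x)%:E by move=> Dx; rewrite lee_fin f0.
set h := fun y => (f y + c)%:E.
have mhn : measurable_fun D h^\- by exact: measurable_funeneg.
have mhp : measurable_fun D h^\+ by exact: measurable_funepos.
pose cp := Num.max c 0%R; pose cn := Num.max (- c)%R 0%R.
have cp0 : (0 <= cp)%R by rewrite le_max lexx orbT.
have cn0 : (0 <= cn)%R by rewrite le_max lexx orbT.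
have cE : c = (cp - cn)%R.
  by rewrite /cp /cn; case: (lerP c 0); case: (lerP (- c)%R 0); lra.
have cstE (k : R) : \int[nu]_(x in D) k%:E = (k * m)%:E.
  by rewrite integral_cst// nuD.
have eqI : \int[nu]_(x in D) (f x)%:E + (cp * m)%:E + \int[nu]_(x in D) h^\- x =
    \int[nu]_(x in D) h^\+ x + (cn * m)%:E.
  rewrite -!cstE -!ge0_integralD//; last 2 first.
  - by move=> x Dx; rewrite adde_ge0// f0E.
  - exact: emeasurable_funD.
  apply: eq_integral => x _; rewrite funeposE funenegE /h -EFinN -!EFin_max -!EFinD.
  congr EFin; rewrite [X in (_ + Num.max X _)%R](_ : _ = - (f x + c))%R//.
  have -> : (f x + c = f x + cp - cn)%R by rewrite {1}cE; ring.
  by case: (lerP (f x + cp - cn)%R 0); case: (lerP (- (f x + cp - cn))%R 0); lra.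
rewrite [LHS]integralE; have := integral_shift_funeneg; rewrite -/h.
move: eqI; set J := \int[nu]_(x in D) (f x)%:E.
set N := \int[nu]_(x in D) h^\- x; set Q := \int[nu]_(x in D) h^\+ x.
move=> eqI Nfin; clearbody J N Q.
have -> : Q = J + (cp * m)%:E + N - (cn * m)%:E by rewrite eqI -addeA subee// adde0.
rewrite -!addeA; congr (_ + _); case: N Nfin {eqI} => // r _.
by rewrite -!EFinN -!EFinD cE; congr EFin; ring.
Qed.

Lemma ge0_integral_shiftN :
  \int[nu]_(x in D) (- c - f x)%:E = (- c * m)%:E - \int[nu]_(x in D) (f x)%:E.
Proof.
transitivity (\int[nu]_(x in D) - (f x + c)%:E).
  by apply: eq_integral => x _; rewrite -EFinN opprD addrC.
rewrite integralN; last first.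
  by rewrite fin_num_adde_defl// fin_numN integral_shift_funeneg.
by rewrite ge0_integral_shift fin_num_oppeD// addeC mulNr EFinN.
Qed.

End IntegralShift.

(** * Markov's inequality for sums *)

Lemma sume_const (R : realType) (n : nat) (x : \bar R) :
  \sum_(i < n) x = n%:R%:E * x.
Proof.
elim: n => [|n IH]; first by rewrite big_ord0 mul0e.
by rewrite big_ord_recr/= IH -natr1 EFinD ge0_muleDl ?mul1e// lee_fin.
Qed.

(** Linearity of the integral requires nothing of the dependence between the [Y i]. The product form
    remains meaningful for [a = 0] and for infinite [J]. *)
Lemma sum_markov d (T : measurableType d) (R : realType)
    (nu : {measure set T -> \bar R}) (n : nat) (Y : 'I_n -> T -> R) (J : \bar R)
    (A : set T) (a : R) :
  (forall i, measurable_fun setT (Y i)) -> (forall i x, (0 <= Y i x)%R) ->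
  (forall i, \int[nu]_x (Y i x)%:E = J) ->
  measurable A -> (0 <= a)%R ->
  (forall x, A x -> (a <= \sum_(i < n) Y i x)%R) ->
  a%:E * nu A <= n%:R%:E * J.
Proof.
move=> mY Y0 YJ mA a0 aY.
have mYE i : measurable_fun setT (fun x => (Y i x)%:E) by exact/measurable_EFinP.
have Y0E i x : 0 <= (Y i x)%:E by rewrite lee_fin.
rewrite -integral_cst//.
apply: (@le_trans _ _ (\int[nu]_(x in A) (\sum_(i < n) (Y i x)%:E))).
  apply: ge0_le_integral => //.
  - by apply: measurable_funTS; exact: emeasurable_sum.
  - by move=> x Ax; rewrite sumEFin lee_fin aY.
apply: (@le_trans _ _ (\int[nu]_x (\sum_(i < n) (Y i x)%:E))).
  apply: ge0_subset_integral => //; first exact: emeasurable_sum.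
  by move=> x _; apply: sume_ge0 => i _.
rewrite ge0_integral_sum//.
rewrite (eq_bigr (fun=> J)) => [|i _]; last exact: YJ.
by rewrite sume_const.
Qed.

(** * The law of a variable with cdf [F] as the law of the quantile *)

Section Law.
Context (R : realType) (F : cumulativeBounded (0 : R)%R (1 : R)%R).
Local Notation g := (fun t => fine (quantile F t)).
Local Notation I01 := (`](0 : R)%R, (1 : R)%R[%classic : set R).

(** A Lebesgue-Stieltjes measure is determined by its values on the intervals []a, b]], where both
    sides are [F b - F a]. *)
Lemma has_cdf_distribution d (T : measurableType d) (P : probability T R)
    (X : {RV P >-> R}) (A : set R) : has_cdf F X -> measurable A ->
  distribution P X A = lebesgue_stieltjes_measure F A.
Proof.
move=> XF mA; symmetry.
have mX : measurable_fun setT (X : T -> measurableTypeR R).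
  exact: (measurable_funPT X).
pose mX' := isMeasurableFun.Build _ _ _ _ (X : T -> measurableTypeR R) mX.
pose Y : {mfun T >-> measurableTypeR R} := HB.pack (X : T -> measurableTypeR R) mX'.
have -> : distribution P X A = distribution P Y A by [].
apply: (lebesgue_stieltjes_measure_unique (mu := distribution P Y)) => // _ [[a b]] _ <-/=.
rewrite /lebesgue_stieltjes_measure /measure_extension/=.
rewrite measurable_mu_extE/=; last exact: is_ocitv.
have [ab | ba] := leP a b; last first.
  by rewrite set_itv_ge ?wlength0 ?measure0// bnd_simp -leNgt ltW.
rewrite wlength_itv_bnd//.
have -> : `]a, b]%classic = `]-oo, b] `\` `]-oo, a].
  by rewrite -[RHS]setCK setCD setCitvl setUC -[LHS]setCK setCitv.
rewrite measureD//; last by rewrite -ge0_fin_numE// fin_num_measure.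
rewrite setIidr; last exact: subset_itvl.
by rewrite -[X in _ = X - _]/(cdf X b) -[X in _ = _ - X]/(cdf X a) !XF.
Qed.
Lemma measurable_fine_quantile : measurable_fun I01 g.
Proof.
apply: measurableT_comp => //; apply: measurable_funS (measurable_quantile01 F) => //.
by move=> t /=; rewrite !in_itv/= => /andP[/ltW -> /ltW ->].
Qed.

Lemma uniform_prob01_in (A : set R) : measurable A ->
  uniform_prob (@ltr01 R) A = uniform_prob (@ltr01 R) (A `&` I01).
Proof.
move=> mA; rewrite (@measureDI _ _ _ (uniform_prob (@ltr01 R)) A I01)//.
rewrite [X in X + _](_ : _ = 0) ?add0e//.
apply: (@subset_measure0 _ _ _ (uniform_prob (@ltr01 R)) _ (~` I01)).
- exact: measurableD.
- exact: measurableC.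
- by move=> x [].
- exact: uniform_prob01_setC.
Qed.

(** Under the uniform law the quantile also has cdf [F], so [X] and the quantile have the same
    distribution. As [h] is nonnegative, both integrals may be infinite. *)
Lemma law_quantile d (T : measurableType d) (P : probability T R)
    (X : {RV P >-> R}) (h : R -> \bar R) : has_cdf F X ->
  measurable_fun setT h -> (forall x, 0 <= h x) ->
  \int[P]_w h (X w) = \int[lebesgue_measure]_(t in I01) h (g t).
Proof.
(* Extension by zero outside [(0, 1)], a null set for the uniform law, gives a function measurable
   on the whole line. *)
move=> XF mh h0; pose q := (g \_ I01)%R.
have mq : measurable_fun setT (q : measurableTypeR R -> R).
  by apply/(measurable_restrictT _ _).1 => //; exact: measurable_fine_quantile.
have [Y YE] := RV_of_measurable (uniform_prob (@ltr01 R)) mq.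
have qE t : I01 t -> q t = g t by move=> It; rewrite /q patchE mem_set.
have YF : has_cdf F Y.
  move=> x; rewrite cdfE -[LHS]/(uniform_prob (@ltr01 R) [set w | (Y w <= x)%R]).
  rewrite uniform_prob01_in; last exact: measurable_RV_le.
  rewrite -(@uniform_prob01_ray _ (F x)); last by rewrite cumulative_ge0 cumulative_le1.
  rewrite [RHS]uniform_prob01_in//; congr (uniform_prob _ _).
  have leE t : I01 t -> (q t <= x)%R = (t <= F x)%R.
    rewrite /= in_itv/= => It; rewrite qE/= ?in_itv//= -lee_fin.
    by rewrite fineK ?quantile_fin_num// quantile_leE//; have /andP[] := It.
  by apply/seteqP; split => t /= [+ It]; rewrite YE in_itv/= leE.
rewrite -[LHS](@ge0_integral_distribution _ _ _ _ _ P X h)//.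
rewrite (eq_measure_integral (distribution (uniform_prob (@ltr01 R)) Y)); last first.
  move=> A mA _; transitivity (lebesgue_stieltjes_measure F A).
    exact: has_cdf_distribution.
  by symmetry; exact: has_cdf_distribution.
have mhY : measurable_fun setT (h \o Y) by apply: measurableT_comp.
rewrite ge0_integral_distribution// integral_uniform; last 2 first.
- exact: mhY.
- by move=> t /=.
rewrite subr0 invr1 mul1e integral_itv_bndoo.
  by apply: eq_integral => t; rewrite inE => It /=; rewrite YE qE.
by have := measurable_funTS (D := I01) mhY.
Qed.

End Law.

(** * Tail means and the Markov bounds *)

Section TailMeans.
Context (R : realType) (F : cumulativeBounded (0 : R)%R (1 : R)%R).
Local Notation g := (fun t => fine (quantile F t)).
Local Notation I01 := (`](0 : R)%R, (1 : R)%R[%classic : set R).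

Lemma fine_quantile_nondecreasing (s t : R) :
  (0 < s)%R -> (s <= t)%R -> (t < 1)%R -> (g s <= g t)%R.
Proof.
move=> s0 st t1.
by apply: (fine_quantile_le (ltW s0) (quantile_gtNy F s0) (quantile_lty F t1)).
Qed.

Lemma lebesgue_measure_oo (a b : R) : (a <= b)%R ->
  lebesgue_measure (`]a, b[%classic : set R) = (b - a)%:E.
Proof.
move=> ab; rewrite lebesgue_measure_itv/= lte_fin; case: ltP => // ba.
by have -> : a = b; [apply/le_anti; rewrite ab|rewrite subrr].
Qed.

(** The endpoints, where the quantile may be infinite, form a null set. *)
Lemma integral_quantile_itv (a b : R) : (0 <= a)%R -> (b <= 1)%R ->
  \int[lebesgue_measure]_(t in `[a, b]) quantile F t =
  \int[lebesgue_measure]_(t in `]a, b[) (g t)%:E.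
Proof.
move=> a0 b1; rewrite integral_itv_bndoo; last first.
  apply: measurable_funS (measurable_quantile01 F) => // t /=.
  by rewrite !in_itv/= => /andP[? ?]; lra.
apply: eq_integral => t; rewrite inE/= in_itv/= => /andP[? ?].
by rewrite fineK// quantile_fin_num//; lra.
Qed.

Lemma integral_supported (a b : R) (h : R -> R) : (0 <= a)%R -> (a < b)%R -> (b <= 1)%R ->
  measurable_fun I01 h -> (forall x, I01 x -> (0 <= h x)%R) ->
  (forall x, I01 x -> ~~ (a < x < b)%R -> h x = 0%R) ->
  \int[lebesgue_measure]_(t in I01) (h t)%:E =
  \int[lebesgue_measure]_(t in `]a, b[) (h t)%:E.
Proof.
move=> a0 ab b1 mh h0 hout.
rewrite [LHS]integral_mkcond [RHS]integral_mkcond; apply: eq_integral => t _.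
rewrite !patchE; case: ifPn => tI; case: ifPn => tab //.
- rewrite (hout t (set_mem tI))//; apply/negP => tab'; move/negP: tab; apply.
  by apply/mem_set; rewrite /= in_itv.
- move: tI tab; rewrite notin_setE/= inE/= !in_itv/= => tI /andP[? ?].
  by case: tI; lra.
Qed.

Variable p : R.
Hypothesis p01 : (0 < p < 1)%R.

Lemma measurable_excess (c : R) :
  measurable_fun I01 (fun t => (Num.max (g t - c) 0)%R).
Proof.
apply: measurable_maxr => //; apply: measurable_funB => //.
exact: measurable_fine_quantile.
Qed.

Lemma measurable_deficit (c : R) :
  measurable_fun I01 (fun t => (Num.max (c - g t) 0)%R).
Proof.
apply: measurable_maxr => //; apply: measurable_funB => //.
exact: measurable_fine_quantile.
Qed.

(** On [(p, 1)] the quantile is [g p] plus its excess, and below [p] the excess vanishes.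
    Integrating over all of [(0, 1)] matches [law_quantile]. *)
Lemma mu_excess : mu F p 1 = (g p)%:E + ((1 - p)^-1)%:E *
  \int[lebesgue_measure]_(t in I01) (Num.max (g t - g p) 0)%:E.
Proof.
have /andP[p0 p1] := p01.
rewrite (@integral_supported p 1)//; last 4 first.
- exact: ltW.
- exact: measurable_excess.
- by move=> x _; rewrite le_max lexx orbT.
- move=> x /=; rewrite in_itv/= => /andP[x0 x1]; rewrite x1 andbT -leNgt => xp.
  by apply/max_idPr; rewrite subr_le0 fine_quantile_nondecreasing.
rewrite /mu integral_quantile_itv ?(ltW p0)//.
have -> : \int[lebesgue_measure]_(t in `]p, (1 : R)%R[) (g t)%:E =
    \int[lebesgue_measure]_(t in `]p, (1 : R)%R[) (Num.max (g t - g p) 0 + g p)%:E.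
  apply: eq_integral => t; rewrite inE/= in_itv/= => /andP[pt t1]; congr EFin.
  have := fine_quantile_nondecreasing p0 (ltW pt) t1.
  by rewrite -subr_ge0 => /max_idPl ->; rewrite subrK.
rewrite (ge0_integral_shift (m := 1 - p))//; last 3 first.
- by apply: lebesgue_measure_oo; exact: ltW.
- apply: measurable_funS (measurable_excess (g p)) => // t /=.
  by rewrite !in_itv/= => /andP[pt ->]; rewrite (lt_trans p0).
- by move=> x _; rewrite le_max lexx orbT.
rewrite addeC muleDr//.
by rewrite -EFinM mulrCA mulVf ?mulr1// subr_eq0 gt_eqF.
Qed.

Lemma mu_deficit : mu F 0 p = (g p)%:E - (p^-1)%:E *
  \int[lebesgue_measure]_(t in I01) (Num.max (g p - g t) 0)%:E.
Proof.
have /andP[p0 p1] := p01.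
rewrite (@integral_supported 0 p)//; last 4 first.
- exact: ltW.
- exact: measurable_deficit.
- by move=> x _; rewrite le_max lexx orbT.
- move=> x /=; rewrite in_itv/= => /andP[x0 x1]; rewrite x0/= -leNgt => px.
  by apply/max_idPr; rewrite subr_le0 fine_quantile_nondecreasing.
rewrite /mu subr0 integral_quantile_itv ?(ltW p1)//.
have -> : \int[lebesgue_measure]_(t in `](0 : R)%R, p[) (g t)%:E =
    (* The double negation matches [ge0_integral_shiftN] with [c = - g p]. *)
    \int[lebesgue_measure]_(t in `](0 : R)%R, p[) (- (- g p) - Num.max (g p - g t) 0)%:E.
  apply: eq_integral => t; rewrite inE/= in_itv/= => /andP[t0 tp]; congr EFin.
  have := fine_quantile_nondecreasing t0 (ltW tp) p1.
  by rewrite -subr_ge0 => /max_idPl ->; rewrite opprK subKr.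
rewrite (ge0_integral_shiftN (m := p))//; last 3 first.
- by rewrite -[p in RHS]subr0; apply: lebesgue_measure_oo; exact: ltW.
- apply: measurable_funS (measurable_deficit (g p)) => // t /=.
  by rewrite !in_itv/= => /andP[-> pt]; rewrite (lt_trans pt).
- by move=> x _; rewrite le_max lexx orbT.
rewrite opprK muleDr//.
by rewrite -EFinM mulrCA mulVf ?mulr1 ?gt_eqF// muleN.
Qed.

Context (d : measure_display) (T : measurableType d) (P : probability T R).

Lemma probability_gt_cdf (S : {RV P >-> R}) (x : R) : P [set w | (x < S w)%R] = 1 - cdf S x.
Proof.
rewrite cdfE -probability_setC; last exact: measurable_RV_le.
by congr (P _); apply/seteqP; split => w /=; rewrite ltNge => /negP.
Qed.

(** For every [e > 0], Markov's inequality on the event [S > v], with [v] equal to the bound plus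
    [e], shows that the cdf of [S] reaches [p] at [v]. *)
Lemma VaR_le_mu (n : nat) (S : {RV P >-> R}) : sums P F n S ->
  VaR p S <= n%:R%:E * mu F p 1.
Proof.
move=> [X [XF SE]]; have /andP[p0 p1] := p01.
rewrite mu_excess; set J := integral _ _ _.
have J0 : 0 <= J.
  by apply: integral_ge0 => t _; rewrite lee_fin le_max lexx orbT.
rewrite muleDr ?fin_num_adde_defr// muleCA.
have XJ i : \int[P]_w (Num.max (X i w - g p) 0)%:E = J.
  rewrite (law_quantile (h := fun x => (Num.max (x - g p) 0)%:E) (XF i))//.
  - apply/measurable_EFinP; apply: measurable_maxr => //.
    exact: measurable_funB.
  - by move=> x; rewrite lee_fin le_max lexx orbT.
have := @sum_markov _ _ _ P n (fun i w => (Num.max (X i w - g p) 0)%R) J.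
have : 0 <= n%:R%:E * J by rewrite mule_ge0// lee_fin.
(* An infinite product makes the bound [+oo]. If [n = 0] the product is [0] even for infinite [J],
   and belongs to the finite case. *)
case: (n%:R%:E * J) => [k| |]//; last first.
  move=> _ _; rewrite mulry gtr0_sg ?invr_gt0 ?subr_gt0// mul1e addey ?leey//.
rewrite lee_fin => k0 markov; apply/lee_addgt0Pr => e e0.
rewrite -!EFinM -!EFinD; set v := (_ + e)%R.
apply: ereal_inf_lbound; exists v => //=.
have vE : (v - n%:R * g p = (1 - p)^-1 * k + e)%R by rewrite /v; ring.
have q0 : (0 <= (1 - p)^-1 * k)%R by rewrite mulr_ge0// invr_ge0 subr_ge0 ltW.
have : (v - n%:R * g p)%:E * P [set w | (v < S w)%R] <= k%:E.
  apply: markov => [i|i x||||w vS].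
  - by apply: measurable_maxr => //; exact: measurable_funB.
  - by rewrite le_max lexx orbT.
  - exact: XJ.
  - have := measurableC (measurable_RV_le S v).
    by congr measurable; apply/seteqP; split => w /=; rewrite ltNge => /negP.
  - by rewrite vE addr_ge0// ltW.
  - apply: (@le_trans _ _ (\sum_(i < n) (X i w - g p))%R); last first.
      by apply: ler_sum => i _; rewrite le_max lexx.
    by rewrite sumrB -SE sumr_const card_ord -[(g p *+ n)%R]mulr_natl lerD2r ltW.
have cfin : cdf S v \is a fin_num by exact: fin_num_measure.
rewrite probability_gt_cdf -(fineK cfin); set c := fine (cdf S v).
rewrite -EFinB -EFinM !lee_fin.
rewrite vE => h; rewrite leNgt; apply/negP => cp.
(* The slack [e] keeps this factor positive even when [k = 0]; the left side is [k + e * (1 - p)],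
   which exceeds the Markov bound [k]. *)
have : (((1 - p)^-1 * k + e) * (1 - p) < ((1 - p)^-1 * k + e) * (1 - c))%R.
  by rewrite ltr_pM2l; [lra|rewrite ltr_wpDl].
rewrite mulrDl mulrAC mulVf ?subr_eq0 ?gt_eqF// mul1r.
have : (0 < e * (1 - p))%R by rewrite mulr_gt0 ?subr_gt0.
lra.
Qed.

(** Every [x] with [p <= cdf S x] is shown to exceed or equal the bound. If [x < n * g p], the
    deficits add up to at least [n * g p - x] on the event [S <= x], whose probability is at least
    [p], so no slack is required. *)
Lemma mu_le_VaR (n : nat) (S : {RV P >-> R}) : sums P F n S ->
  n%:R%:E * mu F 0 p <= VaR p S.
Proof.
move=> [X [XF SE]]; have /andP[p0 p1] := p01.
rewrite mu_deficit; set J := integral _ _ _.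
have J0 : 0 <= J.
  by apply: integral_ge0 => t _; rewrite lee_fin le_max lexx orbT.
rewrite muleBr ?fin_num_adde_defr// muleCA.
have XJ i : \int[P]_w (Num.max (g p - X i w) 0)%:E = J.
  rewrite (law_quantile (h := fun x => (Num.max (g p - x) 0)%:E) (XF i))//.
  - apply/measurable_EFinP; apply: measurable_maxr => //.
    exact: measurable_funB.
  - by move=> x; rewrite lee_fin le_max lexx orbT.
have := @sum_markov _ _ _ P n (fun i w => (Num.max (g p - X i w) 0)%R) J.
have : 0 <= n%:R%:E * J by rewrite mule_ge0// lee_fin.
case: (n%:R%:E * J) => [k| |]//; last first.
  by rewrite mulry gtr0_sg ?invr_gt0// mul1e addeNy// leNye.
rewrite lee_fin => k0 markov.
apply: le_ereal_inf_tmp => _ [x /= px <-].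
rewrite -EFinM -EFinD lee_fin.
have q0 : (0 <= p^-1 * k)%R by rewrite mulr_ge0// invr_ge0 ltW.
have [xc|xc] := leP (n%:R * g p)%R x; first lra.
have : (n%:R * g p - x)%:E * P [set w | (S w <= x)%R] <= k%:E.
  apply: markov => [i|i y||||w vS].
  - by apply: measurable_maxr => //; exact: measurable_funB.
  - by rewrite le_max lexx orbT.
  - exact: XJ.
  - exact: measurable_RV_le.
  - by rewrite subr_ge0 ltW.
  - apply: (@le_trans _ _ (\sum_(i < n) (g p - X i w))%R); last first.
      by apply: ler_sum => i _; rewrite le_max lexx.
    by rewrite sumrB -SE sumr_const card_ord -[(g p *+ n)%R]mulr_natl lerD2l lerN2.
have cfin : cdf S x \is a fin_num by exact: fin_num_measure.
move: px; rewrite -cdfE -(fineK cfin); set c := fine (cdf S x).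
rewrite -EFinM !lee_fin => pc.
move=> h.
have : ((n%:R * g p - x) * p <= k)%R.
  by apply: le_trans h; rewrite ler_pM2l// subr_gt0.
by rewrite -ler_pdivlMr// mulrC; lra.
Qed.

End TailMeans.

(** * Bounds attained through the rotated sums *)

Section SharpBounds.
Context (R : realType) (d : measure_display) (T : measurableType d)
  (P : probability T R) (F : cumulativeBounded (0 : R)%R (1 : R)%R)
  (p : R) (n : nat).
Hypotheses (P_rich : generates_independent_vectors P) (p01 : (0 < p < 1)%R).
Local Notation g := (fun t => fine (quantile F t)).

(* [VaR p] is a left quantile, so controlling [S] on [U > p] would only bound
   the cdf of [S] by [p], not strictly; hence the rotation on [r, q] with
   [r < p] and, afterwards, the limit [r -> p]. *)
Lemma sup_VaR_ge_left (q r m : R) : (0 <= r)%R -> (r < p)%R -> (p < q)%R -> (q <= 1)%R ->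
  -oo < quantile F r -> quantile F q < +oo -> mu F r q = m%:E ->
  (n%:R * m - (g q - g r))%:E <= sup_VaR P F n p.
Proof.
move=> r0 rp pq q1 rNy qy muE.
have rq := lt_trans rp pq.
have [U [S [Uunif SF Slo _]]] := rotated_sum n P_rich r0 rq q1 rNy qy muE.
apply: (@le_trans _ _ (VaR p S)); last by apply: ereal_sup_ubound; exists S.
apply: le_ereal_inf_tmp => _ [x /= px <-]; rewrite lee_fin leNgt; apply/negP => xlt.
suff : cdf S x <= r%:E by move=> /(le_trans px); rewrite lee_fin leNgt rp.
rewrite -Uunif; last by have /andP[] := p01; lra.
rewrite !cdfE; apply: le_measure; rewrite ?inE; try exact: measurable_RV_le.
move=> w /= Sx; rewrite leNgt; apply/negP => /Slo.
by move/(le_trans)/(_ Sx); rewrite leNgt xlt.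
Qed.

(** As [r] increases to [p], left continuity brings [F^{-1}(r)] to [F^{-1}(p)], and [mu F r q] tends
    to [mu F p q]. *)
Lemma sup_VaR_lower_bound (q : R) : (p < q <= 1)%R ->
  sup_lower_bound F n p q <= sup_VaR P F n p.
Proof.
move=> /andP[pq q1]; have /andP[p0 p1] := p01.
rewrite /sup_lower_bound; case: eqVneq => [_|qoo]; first exact: leNye.
have qy : quantile F q < +oo by rewrite ltey.
(* A fixed positive base point has a finite quantile, so one primitive [H] covers all the candidates
   for [r]. *)
pose r0 := (p / 2)%R.
have r0p : (0 < r0 < p)%R by rewrite /r0; lra.
have [r00 r0p'] := andP r0p.
have r0Ny := quantile_gtNy F r00.
have [H [Hg Hmu]] := quantile_primitive (ltW r00) q1 r0Ny qy.
have fin := quantile_finite (ltW r00) r0Ny qy.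
have Qp : quantile F p = (g p)%:E by rewrite fineK// fin//; lra.
have Qq : quantile F q = (g q)%:E by rewrite fineK// fin//; lra.
set m := ((H q - H p) / (q - p))%R.
have muE : mu F p q = m%:E by rewrite Hmu// ltW.
have mE : (m * (q - p) = H q - H p)%R by rewrite /m divfK//; lra.
have gpm : (g p <= m)%R.
  have /andP[+ _] := Hg p q (ltW r0p') (ltW pq) (lexx q).
  by rewrite -mE ler_pM2r// subr_gt0.
rewrite muE Qp Qq -EFinM -!EFinB.
apply/lee_subgt0Pr => e e0; rewrite -EFinB.
(* The error [e1] is spent [n] times on the mean and once on the quantile at [r]. *)
pose e1 := (e / n.+1%:R)%R.
have e10 : (0 < e1)%R by rewrite divr_gt0.
have e1E : (n%:R * e1 + e1 = e)%R.
  by rewrite -{2}[e1]mul1r -mulrDl natr1 /e1 mulrCA divff ?mulr1// pnatr_eq0.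
have [s /andP[s0 sp] sQ] : exists2 s, (0 <= s < p)%R &
    forall t, (s < t)%R -> (g p - e1)%:E < quantile F t.
  by apply: quantile_left_approx => //; rewrite Qp lte_fin; lra.
(* Chosen so that [p - r <= dl] gives [(m - g p) * (p - r) <= e1 * (q - p)]; the [1] keeps the
   denominator positive when [m = g p]. *)
pose dl := (e1 * (q - p) / (m - g p + 1))%R.
have den0 : (0 < m - g p + 1)%R by lra.
have dl0 : (0 < dl)%R by rewrite divr_gt0// mulr_gt0// subr_gt0.
pose r := Num.max (Num.max r0 ((s + p) / 2)%R) (p - dl)%R.
have rp : (r < p)%R by rewrite /r !gt_max; apply/andP; split; [apply/andP; split|]; lra.
have r0r : (r0 <= r)%R by rewrite /r !le_max lexx.
have sr : (s < r)%R.
  apply: (@lt_le_trans _ _ ((s + p) / 2)%R); first lra.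
  by rewrite /r !le_max lexx orbT.
have dlr : (p - r <= dl)%R.
  have : (p - dl <= r)%R by rewrite /r !le_max lexx orbT.
  lra.
have rNy : -oo < quantile F r by apply: quantile_gtNy; lra.
have gr : (g p - e1 <= g r)%R.
  by have := sQ r sr; rewrite -[quantile F r]fineK ?lte_fin; [exact: ltW|apply: fin; lra].
have rq := lt_trans rp pq.
set m' := ((H q - H r) / (q - r))%R.
have mrE : mu F r q = m'%:E by rewrite Hmu.
have m'E : (m' * (q - r) = H q - H r)%R by rewrite /m' divfK//; lra.
have mm' : (m - e1 <= m')%R.
  rewrite -(ler_pM2r (_ : 0 < q - r)%R) ?subr_gt0// m'E.
  have /andP[Hr _] := Hg r p r0r (ltW rp) (ltW pq).
  have h1 : ((g p - e1) * (p - r) <= g r * (p - r))%R by rewrite ler_pM2r// subr_gt0.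
  have h2 : ((m - g p) * (p - r) <= e1 * (q - p))%R.
    apply: (@le_trans _ _ ((m - g p + 1) * dl)%R).
      by apply: ler_pM => //; lra.
    by rewrite /dl mulrCA divff ?mulr1// gt_eqF.
  have -> : ((m - e1) * (q - r) =
      m * (q - p) + (m - g p) * (p - r) + g p * (p - r) - e1 * (p - r) - e1 * (q - p))%R by ring.
  by rewrite mE; rewrite mulrBl in h1; lra.
apply: le_trans (sup_VaR_ge_left _ rp pq q1 rNy qy mrE); last lra.
rewrite lee_fin.
have : (n%:R * (m - e1) <= n%:R * m')%R by rewrite ler_wpM2l.
by rewrite mulrBr; lra.
Qed.

(** The event [U <= p] is contained in [S <= x], so [p <= cdf S x], exactly what a left quantile
    asks for. Hence no limit is taken here. *)
Lemma inf_VaR_upper_bound (q : R) : (0 <= q < p)%R ->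
  inf_VaR P F n p <= inf_upper_bound F n p q.
Proof.
move=> /andP[q0 qp]; have /andP[p0 p1] := p01.
rewrite /inf_upper_bound; case: eqVneq => [_|qoo]; first exact: leey.
have qNy : -oo < quantile F q by rewrite ltNye.
have py := quantile_lty F p1.
have [H [_ Hmu]] := quantile_primitive q0 (ltW p1) qNy py.
have fin := quantile_finite q0 qNy py.
have Qp : quantile F p = (g p)%:E by rewrite fineK// fin//; lra.
have Qq : quantile F q = (g q)%:E by rewrite fineK// fin//; lra.
have muE := Hmu q p (lexx q) qp (lexx p).
have [U [S [Uunif SF _ Sup]]] := rotated_sum n P_rich q0 qp (ltW p1) qNy py muE.
apply: (@le_trans _ _ (VaR p S)); first by apply: ereal_inf_lbound; exists S.
rewrite muE Qp Qq -EFinM -EFinB -EFinD.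
apply: ereal_inf_lbound; set x := (_ + _)%R; exists x => //=.
rewrite -Uunif; last lra.
rewrite !cdfE; apply: le_measure; rewrite ?inE; try exact: measurable_RV_le.
by move=> w /= /Sup.
Qed.

End SharpBounds.

(** * Distributions on a bounded interval *)

Section BoundedSupport.
Context (R : realType) (F : cumulativeBounded (0 : R)%R (1 : R)%R) (a b : R).
Hypothesis Fab : lebesgue_stieltjes_measure F `[a, b] = 1.

Lemma cumulative_ray (x : R) : lebesgue_stieltjes_measure F `]-oo, x] = (F x)%:E.
Proof.
by rewrite -cdf_lebesgue_stieltjes_id /cdf /distribution /pushforward preimage_id.
Qed.

Lemma quantile1_le : quantile F 1 <= b%:E.
Proof.
rewrite quantile_leE// -lee_fin -cumulative_ray -Fab.
apply: le_measure; rewrite ?inE//.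
by move=> t /=; rewrite !in_itv/= => /andP[].
Qed.

(** For [x < a] the ray up to [x] lies in the null complement of [[a, b]], so [F x = 0]. *)
Lemma quantile0_ge : a%:E <= quantile F 0.
Proof.
rewrite /quantile eqxx; apply: le_ereal_inf_tmp => _ [x /= x0 <-].
rewrite lee_fin leNgt; apply/negP => xa; move: x0; rewrite -lte_fin -cumulative_ray.
rewrite (_ : lebesgue_stieltjes_measure F _ = 0) ?ltxx//.
apply: (@subset_measure0 _ _ _ (lebesgue_stieltjes_measure F) _ (~` `[a, b]%classic)) => //.
- exact: measurableC.
- move=> t /=; rewrite !in_itv/= => tx /andP[at_ _].
  by have := le_lt_trans (le_trans at_ tx) xa; rewrite ltxx.
- have := @probability_setC _ _ _ (lebesgue_stieltjes_measure F) `[a, b]%classic (measurable_itv _).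
  by rewrite [in X in _ = X -> _]/= Fab subee.
Qed.

End BoundedSupport.

Theorem theorem3p4 (R : realType) (d : measure_display) (T : measurableType d)
    (P : probability T R)
    (P_atomless : atomless P)
    (P_rich : generates_independent_vectors P)
    (F : cumulativeBounded (0 : R)%R (1 : R)%R)
    (p : R) (p01 : (0 < p < 1)%R) (n : nat) :
  [/\ forall q : R, (p < q <= 1)%R ->
        sup_lower_bound F n p q <= sup_VaR P F n p <= n%:R%:E * mu F p 1,
      forall q : R, (0 <= q < p)%R ->
        n%:R%:E * mu F 0 p <= inf_VaR P F n p <= inf_upper_bound F n p q
    & forall a b : R, lebesgue_stieltjes_measure F `[a, b] = 1 ->
        (n%:R%:E * mu F p 1 - (b%:E - quantile F p)
           <= sup_VaR P F n p <= n%:R%:E * mu F p 1) /\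
        (n%:R%:E * mu F 0 p <= inf_VaR P F n p
           <= n%:R%:E * mu F 0 p + (quantile F p - a%:E))].
Proof.
have /andP[p0 p1] := p01.
have sup_le : sup_VaR P F n p <= n%:R%:E * mu F p 1.
  by apply: ge_ereal_sup => _ [S SF <-]; exact: VaR_le_mu.
have inf_ge : n%:R%:E * mu F 0 p <= inf_VaR P F n p.
  by apply: le_ereal_inf_tmp => _ [S SF <-]; exact: mu_le_VaR.
split=> [q pq|q qp|a b Fab].
- by rewrite sup_le andbT sup_VaR_lower_bound.
- by rewrite inf_ge inf_VaR_upper_bound.
- have Q1b := quantile1_le Fab; have aQ0 := quantile0_ge Fab.
  rewrite sup_le inf_ge andbT andTb; split.
    (* The bounded case takes [q = 1], and [q = 0] for the infimum; the bounds [F^{-1}(1) <= b] and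
       [a <= F^{-1}(0)] exclude the infinite conventions. *)
    have q1 : (p < (1 : R) <= 1)%R by rewrite p1 lexx.
    apply: le_trans _ (sup_VaR_lower_bound F n P_rich p01 q1).
    rewrite /sup_lower_bound; case: eqVneq => [Q1|_].
      by move: Q1b; rewrite Q1 leye_eq.
    by rewrite leeB// leeB.
  have q0 : (0 <= (0 : R) < p)%R by rewrite p0 lexx.
  apply: le_trans (inf_VaR_upper_bound F n P_rich p01 q0) _.
  rewrite /inf_upper_bound; case: eqVneq => [Q0|_].
    by move: aQ0; rewrite Q0 leeNy_eq.
  by rewrite leeD2l// leeB.
Qed.
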